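(* In the Spitzer algebra $\mathcal{S}\subset A$ (the free noncommutative Spitzer algebra on one generator $X$, inside the weight one Rota--Baxter algebra $(A,R)$ of sequences), one has for every $n\ge 1$ $$(RX)^{[n]}=\sum_{\substack{i_1+\cdots+i_k=n\\ i_1,\dots,i_k>0}}\frac{\mathfrak{L}_1^{(i_1)}(X)\cdot\ \cdots\ \cdot\mathfrak{L}_1^{(i_k)}(X)}{i_1(i_1+i_2)\cdots(i_1+\cdots+i_k)}.$$
   Context: The ground field $\mathbb{K}$ has characteristic zero. Let $x_1,x_2,\dots$ be noncommuting variables and $T(X)$ the free associative $\mathbb{K}$-algebra on them. $A$ is the algebra of sequences $(y_1,y_2,\dots)$ of elements of $T(X)$ with componentwise sum and product; $X:=(x_1,x_2,\dots)\in A$. The operator $R(y_1,y_2,\dots):=(0,y_1,y_1+y_2,y_1+y_2+y_3,\dots)$ is a Rota--Baxter operator of weight $1$ on $A$, i.e. $R(a)R(b)=R(R(a)b+aR(b)+ab)$. Define $(RX)^{[0]}:=1$, $(RX)^{[1]}:=R(X)$ and $(RX)^{[n+1]}:=R\bigl((RX)^{[n]}\cdot X\bigr)$. The Spitzer algebra $\mathcal{S}$ is the subalgebra of $A$ (for the product $\cdot$) generated by the $(RX)^{[n]}$. The weight one left pre-Lie product on $A$ is $a\triangleright_1 b:=R(a)b-bR(a)-ba$. Set $\mathfrak{l}_1^{(1)}(X):=X$, $\mathfrak{l}_1^{(n+1)}(X):=\mathfrak{l}_1^{(n)}(X)\triangleright_1 X$, and $\mathfrak{L}_1^{(n)}(X):=R\bigl(\mathfrak{l}_1^{(n)}(X)\bigr)$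 for $n\ge 1$. *)

(* Defs.v *)
From HB Require Import structures.
From mathcomp Require Import all_boot all_order all_algebra.
From mathcomp Require Import boolp classical_sets functions.
From mathcomp Require Import monalg.

Set Implicit Arguments.
Unset Strict Implicit.
Unset Printing Implicit Defensive.

Import GRing.Theory.

Local Open Scope classical_set_scope.
Local Open Scope ring_scope.

(* T(X): the monoid algebra over K of the free monoid on letters indexed by
   nat; the letter fmu i stands for x_(i+1). *)
Notation freeAlg K := {malg K[{fmonom nat}]}.

(* Sequences are indexed from 0, so that y i is the component y_(i+1). *)
Definition seqAlg (K : fieldType) : Type := nat -> freeAlg K.

HB.instance Definition _ (K : fieldType) := GRing.NzRing.on (seqAlg K).
HB.instance Definition _ (K : fieldType) := GRing.Lmodule.on (seqAlg K).

Fact seqAlg_scalerAl (K : fieldType) (a : K) (u v : seqAlg K) :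
  a *: (u * v) = a *: u * v.
Proof. by apply/funext => i; rewrite -[LHS]/(a *: (u i * v i)) scalerAl. Qed.

HB.instance Definition _ (K : fieldType) :=
  GRing.Lmodule_isLalgebra.Build K (seqAlg K) (@seqAlg_scalerAl K).

Definition rota_baxter1 (B : pzRingType) (P : B -> B) : Prop :=
  forall a b : B, P a * P b = P (P a * b + a * P b + a * b).

Definition prelie1 (B : pzRingType) (P : B -> B) (a b : B) : B :=
  P a * b - b * P a - b * a.

Section Spitzer.
Variable K : fieldType.
Local Notation A := (seqAlg K).

Definition genX : A := fun i => << fmu i >>.

Definition R (y : A) : A := fun i => \sum_(j < i) y j.

Lemma R_rota_baxter : rota_baxter1 R.
Proof.
have expand (B : pzRingType) (u v x y : B) :
    (u + x) * (v + y) = u * v + (u * y + x * v + x * y).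
  by rewrite mulrDl !mulrDr -!addrA.
have RS y i : R y i.+1 = R y i + y i by exact: big_ord_recr.
have R0 y : R y 0%N = 0 by exact: big_ord0.
move=> a b; apply/funext; elim=> [|i IH].
  by rewrite -[LHS]/(R a 0%N * R b 0%N) !R0 mulr0.
rewrite RS -IH.
rewrite -[LHS]/(R a i.+1 * R b i.+1) -[(R a * R b) i]/(R a i * R b i).
rewrite -[X in _ = _ + X]/(R a i * b i + a i * R b i + a i * b i) !RS.
exact: expand.
Qed.

Fixpoint iterR (n : nat) : A :=
  if n is m.+1 then R (iterR m * genX) else 1.

Lemma iterR1 : iterR 1 = R genX.
Proof. by rewrite /= mul1r. Qed.

Definition spitzer : set A :=
  smallest [set B : set A | GRing.subalg_closed (mem B)] (range iterR).

(* The index starts at 1; the value 0 at index 0 is never used. *)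
Fixpoint lpow (n : nat) : A :=
  match n with
  | 0 => 0
  | 1 => genX
  | (_.+1 as m).+1 => prelie1 R (lpow m) genX
  end.

Definition Lpow (n : nat) : A := R (lpow n).

End Spitzer.

Arguments iterR : clear implicits.
Arguments spitzer : clear implicits.
Arguments lpow : clear implicits.
Arguments Lpow : clear implicits.
Arguments genX : clear implicits.

(* (i_1, ..., i_k) is a composition of n; bounding the parts by n loses
   nothing, since they sum to n. *)
Definition is_comp (n k : nat) (i : {ffun 'I_k -> 'I_n.+1}) : bool :=
  [forall j, (0 < i j)%N] && (\sum_(j < k) i j == n)%N.

(* i_1 (i_1 + i_2) ... (i_1 + ... + i_k) *)
Definition prod_psums (n k : nat) (i : {ffun 'I_k -> 'I_n.+1}) : nat :=
  (\prod_(j < k) \sum_(l < k | l <= j) i l)%N.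

(* Main.v *)
Require Import Defs.
From HB Require Import structures.
From mathcomp Require Import all_boot all_order all_algebra.
From mathcomp Require Import boolp classical_sets functions.
From mathcomp Require Import monalg.

Import GRing.Theory.
Local Open Scope ring_scope.

(** The engine is the identity [n (RX)^[n] = \sum_(1 <= i <= n) (RX)^[n-i] L^(i)],
    valid in every Rota-Baxter algebra of weight one. To prove it, expand
    [(RX)^[n-i] L^(i)] by the Rota-Baxter relation and substitute
    [X L^(i) + X l^(i) = L^(i) X - l^(i+1)], which is the definition of
    [l^(i+1)]: the terms without [L] telescope and the others are the identity
    at [n-1], multiplied by [X] on the right. Dividing by [n] and iterating
    produces the sum over compositions, [i_k] being the last part split off.
    Solving for [L^(n)] instead shows that it lies in the Spitzer algebra. *)

Lemma rota_baxter1_dynkin (B : pzRingType) (P : {additive B -> B}) (x : B)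
    (w l : nat -> B) :
    rota_baxter1 P ->
    w 0%N = 1 -> (forall n, w n.+1 = P (w n * x)) ->
    l 0%N = x -> (forall n, l n.+1 = prelie1 P (l n) x) ->
  forall n, w n *+ n = \sum_(i < n) w (n - i.+1)%N * P (l i).
Proof.
move=> RB w0 wS l0 lS; elim=> [|n IHn]; first by rewrite big_ord0.
(* Since [f 0 = w n * x] and [f n = l n], the telescoped [f 0 - f n] cancels the last summand
   [P (l n)] and supplies one more copy of [w n * x]. *)
pose f k := w (n - k)%N * l k.
have expand (i : 'I_n) : w (n.+1 - i.+1)%N * P (l i) =
    P (w (n - i.+1)%N * P (l i) * x - (f i.+1 - f i)).
  rewrite /f subSS lS /prelie1 -(subnSK (ltn_ord i)) wS RB -wS; congr (P _).
  rewrite !mulrBr !opprB -!mulrA.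
  set a := w _ * (x * P _); set b := w _ * (x * l _).
  set c := w _ * (P _ * x); set d := w _ * l _.
  by rewrite [RHS]addrC -!addrA addNr addr0 [b + a]addrC.
rewrite big_ord_recr /= subnn w0 mul1r (eq_bigr _ (fun i _ => expand i)).
rewrite -raddf_sum sumrB -mulr_suml -IHn -(big_mkord xpredT (fun i => f i.+1 - f i)).
rewrite telescope_sumr // /f subnn subn0 w0 mul1r l0 -raddfD /= opprB -addrA.
by rewrite subrK mulrnAl mulrSr wS raddfD raddfMn.
Qed.

Section CompositionSums.
Variables (K : fieldType) (A : lalgType K) (L : nat -> A).

(* The bound N on the parts is kept apart from their sum n, so that it stays
   fixed when the last part is split off. *)
Definition comp_sum (N k n : nat) : A :=
  \sum_(i : {ffun 'I_k -> 'I_N.+1} |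
      [forall j, (0 < i j)%N] && (\sum_(j < k) i j == n)%N)
    (prod_psums i)%:R^-1 *: \prod_(j < k) L (i j).

Lemma comp_sum0 (N n : nat) : comp_sum N 0 n = (n == 0%N)%:R.
Proof.
rewrite /comp_sum /prod_psums; under eq_bigl => i.
  by rewrite big_ord0 (introT forallP) 1?eq_sym; [over | case].
under eq_bigr do rewrite !big_ord0 invr1 scale1r.
case: eqP => _; last by rewrite big_pred0.
by rewrite sumr_const card_ffun !card_ord.
Qed.

(** The last partial sum of a composition of [n] is [n] itself, and the earlier ones do not involve
    the last part. *)
Lemma comp_sumS (N k n : nat) :
  comp_sum N k.+1 n =
    n%:R^-1 *: \sum_(i < N.+1 | (0 < i <= n)%N) comp_sum N k (n - i) * L i.
Proof.
(* Appends the part [u.1] after [u.2]: [unlift ord_max] is [None] exactly at the last position. *)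
pose snoc (u : 'I_N.+1 * {ffun 'I_k -> 'I_N.+1}) : {ffun 'I_k.+1 -> 'I_N.+1} :=
  [ffun j => oapp u.2 u.1 (unlift ord_max j)].
have snoc_last u : snoc u ord_max = u.1 by rewrite ffunE unlift_none.
have snoc_widen u j : snoc u (widen_ord (leqnSn k) j) = u.2 j.
  suff -> : widen_ord (leqnSn k) j = lift ord_max j by rewrite ffunE liftK.
  by apply: ord_inj; rewrite lift_max.
have snoc_bij : bijective snoc.
  exists (fun i : {ffun 'I_k.+1 -> 'I_N.+1} =>
      (i ord_max, [ffun j : 'I_k => i (lift ord_max j)])).
    move=> [a g]; rewrite snoc_last; congr pair; apply/ffunP => j.
    by rewrite !ffunE liftK.
  move=> i; apply/ffunP => j; rewrite ffunE.
  by case: unliftP => [j' ->|->] //=; rewrite ffunE.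
rewrite scaler_sumr; under eq_bigr do rewrite mulr_suml scaler_sumr.
rewrite pair_big_dep /comp_sum (reindex snoc) /=; last exact: onW_bij.
have snoc_sum u : (\sum_j snoc u j = \sum_j u.2 j + u.1)%N.
  by rewrite big_ord_recr /= snoc_last; under eq_bigr do rewrite snoc_widen.
apply: eq_big => [u|u /andP[_ /eqP sum_u]].
  have -> : [forall j, (0 < snoc u j)%N] =
      [forall j, (0 < u.2 j)%N] && (0 < u.1)%N.
    apply/forallP/andP => [pos_u|[/forallP pos_u2 pos_u1] j].
      split; last by rewrite -(snoc_last u).
      by apply/forallP => j; rewrite -snoc_widen.
    by rewrite ffunE; case: unliftP => /=.
  rewrite snoc_sum [RHS]andbACA; congr (_ && _); first exact: andbC.
  apply/eqP/andP => [<-|[le_n /eqP ->]]; last by rewrite subnK.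
  by rewrite addnK eqxx leq_addl.
have -> : prod_psums (snoc u) = (prod_psums u.2 * n)%N.
  rewrite /prod_psums big_ord_recr /=; congr (_ * _)%N; last first.
    by rewrite -sum_u; apply: eq_bigl => j; rewrite -ltnS ltn_ord.
  apply: eq_bigr => j _; rewrite big_mkcond big_ord_recr /=.
  rewrite leqNgt ltn_ord addn0 [RHS]big_mkcond.
  by apply: eq_bigr => l _; rewrite snoc_widen.
rewrite big_ord_recr /= snoc_last natrM invfM mulrC -scalerA -scalerAl.
by under eq_bigr do rewrite snoc_widen.
Qed.

Lemma sum_pos_le (V : nmodType) (F : nat -> V) (N n : nat) : (n <= N)%N ->
  \sum_(i < N.+1 | (0 < i <= n)%N) F i = \sum_(i < n) F i.+1.
Proof.
move=> le_nN; rewrite big_mkcond big_ord_recl /= add0r (big_ord_widen N (fun i => F i.+1)) //.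
by rewrite [RHS]big_mkcond.
Qed.

(** In characteristic zero the recursion determines [w], and the composition sums obey it too.
    Positive parts force at most [n] of them, each at most [n], hence the bounds on [M] and [N]. *)
Lemma comp_sum_solves (w : nat -> A) :
    [pchar K] =i pred0 -> w 0%N = 1 ->
    (forall n, w n *+ n = \sum_(i < n) w (n - i.+1)%N * L i.+1) ->
  forall N n M, (n <= N)%N -> (n < M)%N -> w n = \sum_(k < M) comp_sum N k n.
Proof.
move=> /pcharf0P charK0 w0 wE N n.
elim/ltn_ind: n => n IHn [//|M] le_nN le_nM.
(* The empty composition contributes only at [n = 0]; every other one loses its last part. *)
rewrite big_ord_recl comp_sum0; under eq_bigr do rewrite comp_sumS.
rewrite -scaler_sumr exchange_big /=.
case: n => [|n] in IHn le_nN le_nM *.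
  by rewrite big1 ?scaler0 ?addr0 // => i; case: (i : nat).
rewrite add0r; apply: (scalerI (a := n.+1%:R)); first by rewrite charK0.
rewrite scalerA mulfV ?charK0 // scale1r scaler_nat wE.
under [RHS]eq_bigr do rewrite -mulr_suml.
rewrite (sum_pos_le _ (fun i => (\sum_(k < M) comp_sum N k (n.+1 - i)) * L i)) //.
apply: eq_bigr => i _; congr (_ * _); rewrite subSS.
apply: IHn; first by rewrite ltnS leq_subr.
  exact: leq_trans (leq_subr i n) (ltnW le_nN).
exact: leq_ltn_trans (leq_subr i n) le_nM.
Qed.

End CompositionSums.

Section SpitzerAlgebra.
Variable K : fieldType.

Lemma R_zmod_morphism : zmod_morphism (@R K).
Proof. by move=> u v; apply/funext => i; apply: sumrB. Qed.

HB.instance Definition _ :=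
  GRing.isZmodMorphism.Build (seqAlg K) (seqAlg K) (@R K) R_zmod_morphism.

Lemma iterR_dynkin (n : nat) :
  iterR K n *+ n = \sum_(i < n) iterR K (n - i.+1) * Lpow K i.+1.
Proof.
exact: (@rota_baxter1_dynkin _ (@R K) (genX K) (iterR K) (fun i => lpow K i.+1)
  (@R_rota_baxter K)).
Qed.

Lemma iterR_spitzer (n : nat) : iterR K n \in spitzer K.
Proof. by rewrite in_setE => B [_]; apply; exists n. Qed.

Lemma Lpow_spitzer (n : nat) : Lpow K n.+1 \in spitzer K.
Proof.
rewrite in_setE => B [[B1 Blin Bmul] Bw].
have {}Bw m : iterR K m \in mem B by rewrite inE; apply: Bw; exists m.
(* Closure is given as stability under [a *: u + v], from which zero, differences and sums
   follow. *)
have B0 : 0 \in mem B by rewrite -(addNr 1) -scaleN1r Blin.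
have BB u v : u \in mem B -> v \in mem B -> u - v \in mem B.
  by move=> Bu Bv; rewrite addrC -scaleN1r Blin.
have BD u v : u \in mem B -> v \in mem B -> u + v \in mem B.
  by move=> Bu Bv; rewrite -[u]scale1r Blin.
suff: Lpow K n.+1 \in mem B by rewrite inE.
elim/ltn_ind: n => n IHn.
(* [Lpow K n.+1] occurs only in the last summand, with factor [iterR K 0 = 1]. *)
have := iterR_dynkin n.+1; rewrite big_ord_recr /= subnn mul1r.
move=> /esym/(canRL (addKr _)) ->; rewrite addrC BB //.
  by rewrite -scaler_nat -[_ *: _]addr0 Blin // (Bw n.+1).
by elim/big_ind: _ => // i _; rewrite Bmul ?IHn.
Qed.

End SpitzerAlgebra.

Theorem theorem6p1 (K : fieldType) (charK0 : [pchar K] =i pred0)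
    (n : nat) (n_gt0 : (0 < n)%N) :
  [/\ iterR K n \in spitzer K,
      forall i : nat, (0 < i)%N -> Lpow K i \in spitzer K
    & iterR K n =
        \sum_(k < n.+1) \sum_(i : {ffun 'I_k -> 'I_n.+1} | is_comp i)
          (prod_psums i)%:R^-1 *: \prod_(j < k) Lpow K (i j)].
Proof.
split; first exact: iterR_spitzer.
  by case=> // i _; apply: Lpow_spitzer.
(* The bounds are taken as [N = n] and [M = n.+1]. *)
exact: (@comp_sum_solves K (seqAlg K) (Lpow K) (iterR K) charK0 erefl
  (@iterR_dynkin K)).
Qed.
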